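(* Let $\tilde u^* = \bigoplus_{s=1}^{\mathcal N}\tilde u_s^* \in \widetilde V$ be a solution of the constrained minimization problem $$\min_{\tilde u\in\widetilde V}\widetilde E(\tilde u)\quad\text{subject to } B\tilde u=0 .$$ Then $\tilde u^*\in V$ (that is, the local functions agree on all overlaps and hence define a single function $u^*\in V$ by $u^*|_{\widetilde\Omega_s}=\tilde u^*_s|_{\widetilde\Omega_s}$ for every $s$), and it is a solution of the minimization problem $$\min_{u\in V}E(u).$$
   Context: Let $\Omega=\{1,\dots,M\}\times\{1,\dots,N\}$ be a discrete image domain and $V$ the space of all functions $\Omega\to\mathbb R$. Let $T:V\to V$ be an operator and $E:V\to\mathbb R$, $E(u)=\sum_{(i,j)\in\Omega}T(u)_{ij}$. Let $\Omega$ be partitioned into $\mathcal N$ disjoint rectangular subdomains $\Omega_1,\dots,\Omega_{\mathcal N}$. For $D\subset\Omega$, the essential domain $\mathrm{ed}_D(T)$ of $T$ on $D$ is the minimal subset $\tilde D\subset\Omega$ such that $T(u)|_D$ can be expressed with the values of $u|_{\tilde D}$ only. Put $\widetilde\Omega_s=\mathrm{ed}_{\Omega_s}(T)$; it is assumed that $\Omega_s\subset\widetilde\Omega_s$, so that $\{\widetilde\Omega_s\}$ is an overlapping decomposition of $\Omega$. Let $\widetilde V_s=\{v\in V:\operatorname{supp}v\subset\widetilde\Omega_s\}$ and $\widetilde V=\bigoplus_{s=1}^{\mathcal N}\widetilde V_s$ (external direct sum). The local energies are $E_s(u)=\sum_{(i,j)\in\Omega_s}T(u)_{ij}$, which depend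 only on $u|_{\widetilde\Omega_s}$, and $\widetilde E(\tilde u)=\sum_{s=1}^{\mathcal N}E_s(\tilde u_s)$ for $\tilde u=\bigoplus_s\tilde u_s\in\widetilde V$. For $s<t$ let $\widetilde\Gamma_{st}=\widetilde\Omega_s\cap\widetilde\Omega_t$. The jump operator $B$ is the linear operator mapping $\tilde u\in\widetilde V$ to the collection of functions $B\tilde u|_{\widetilde\Gamma_{st}}=\tilde u_s|_{\widetilde\Gamma_{st}}-\tilde u_t|_{\widetilde\Gamma_{st}}$, $s<t$ (a function on the disjoint union of the $\widetilde\Gamma_{st}$). *)

(* Defs.v *)
From HB Require Import structures.
From mathcomp Require Import all_boot all_order all_algebra.
From mathcomp Require Import boolp reals.

Set Implicit Arguments.
Unset Strict Implicit.
Unset Printing Implicit Defensive.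

Import Order.TTheory GRing.Theory Num.Theory.
Local Open Scope ring_scope.

(* Pixels are numbered from 0 instead of 1. *)
Notation pixel M N := ('I_M * 'I_N)%type.

(* [R^o] is [R] seen as a module over itself; it makes [imageSpace R M N] an
   R-vector space. *)
Notation imageSpace R M N := {ffun pixel M N -> R^o}.

Definition is_rectangle (M N : nat) (D : {set pixel M N}) : Prop :=
  exists a b c d : nat,
    D = [set p : pixel M N | (a <= p.1 <= b)%N && (c <= p.2 <= d)%N].

(* [partition] also requires the blocks to be nonempty; injectivity makes
   distinct indices give distinct, hence disjoint, blocks. *)
Definition rectangular_partition (M N K : nat)
    (Om : 'I_K -> {set pixel M N}) : Prop :=
  [/\ injective Om,
      partition [set Om s | s : 'I_K] [set: pixel M N]
    & forall s, is_rectangle (Om s)].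

Section Decomposition.

Variables (R : realType) (M N : nat).
Local Notation V := (imageSpace R M N).

Definition restr (D : {set pixel M N}) (u : V) :
    {ffun {p : pixel M N | p \in D} -> R^o} :=
  [ffun x => u (val x)].

Definition expressible (T : V -> V) (D A : {set pixel M N}) : Prop :=
  exists F : {ffun {p : pixel M N | p \in A} -> R^o} ->
             {ffun {p : pixel M N | p \in D} -> R^o},
    forall u : V, restr D (T u) = F (restr A u).

(* Such a set exists and is unique, see [ess_dom_minset] and
   [ess_dom_least]; the default value of [odflt] is never used. *)
Definition ess_dom (T : V -> V) (D : {set pixel M N}) : {set pixel M N} :=
  odflt setT [pick A | minset (fun A' => `[< expressible T D A' >]) A].

Lemma restr_eqP (D : {set pixel M N}) (u v : V) :
  restr D u = restr D v <-> {in D, forall p, u p = v p}.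
Proof.
split=> [/ffunP uv p pD|uv].
  by have := uv (exist _ p pD); rewrite !ffunE.
by apply/ffunP => -[p pD]; rewrite !ffunE uv.
Qed.

Lemma expressibleP (T : V -> V) (D A : {set pixel M N}) :
  expressible T D A <->
  (forall u v : V, restr A u = restr A v -> restr D (T u) = restr D (T v)).
Proof.
split=> [[F TF] u v uv|TA]; first by rewrite !TF uv.
pose ext (w : {ffun {p : pixel M N | p \in A} -> R^o}) : V :=
  [ffun p => oapp w 0 (insub p)].
exists (fun w => restr D (T (ext w))) => u.
apply: TA; apply/restr_eqP => p pA.
by rewrite ffunE insubT /= ffunE.
Qed.

Lemma expressibleT (T : V -> V) (D : {set pixel M N}) : expressible T D setT.
Proof.
apply/expressibleP => u v /restr_eqP uv; congr (restr D (T _)).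
by apply/ffunP => p; apply: uv; rewrite inE.
Qed.

Lemma expressibleI (T : V -> V) (D A B : {set pixel M N}) :
  expressible T D A -> expressible T D B -> expressible T D (A :&: B).
Proof.
move=> /expressibleP TA /expressibleP TB; apply/expressibleP => u v /restr_eqP uv.
pose w : V := [ffun p => if p \in A then u p else v p].
transitivity (restr D (T w)).
  by apply: TA; apply/restr_eqP => p pA; rewrite ffunE pA.
apply: TB; apply/restr_eqP => p pB; rewrite ffunE; case: ifP => // pA.
by apply: uv; rewrite inE pA.
Qed.

Lemma ess_dom_minset (T : V -> V) (D : {set pixel M N}) :
  minset (fun A => `[< expressible T D A >]) (ess_dom T D).
Proof.
rewrite /ess_dom; case: pickP => //= no.
have [A + _] := @minset_exists _ (fun A => `[< expressible T D A >]) setT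
  (introT (asboolP _) (expressibleT T D)).
by rewrite no.
Qed.

Lemma ess_dom_least (T : V -> V) (D A : {set pixel M N}) :
  expressible T D A -> ess_dom T D \subset A.
Proof.
move=> TA; have /minsetP[/asboolP Te min_e] := ess_dom_minset T D.
apply/setIidPl/min_e; last exact: subsetIl.
exact/asboolP/expressibleI.
Qed.

Definition energy (T : V -> V) (u : V) : R := \sum_(p : pixel M N) T u p.

Variables (K : nat) (T : V -> V) (Om : 'I_K -> {set pixel M N}).

Definition Omt (s : 'I_K) : {set pixel M N} := ess_dom T (Om s).

Definition local_energy (s : 'I_K) (u : V) : R := \sum_(p in Om s) T u p.

Definition local_space (s : 'I_K) : {pred V} :=
  [pred v : V | support v \subset Omt s].

(* The external direct sum of the local spaces, inside V^K. *)
Definition Vt : {pred {ffun 'I_K -> V}} :=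
  [pred ut : {ffun 'I_K -> V} | [forall s, ut s \in local_space s]].

Definition energyt (ut : {ffun 'I_K -> V}) : R :=
  \sum_(s < K) local_energy s (ut s).

Definition interface (s t : 'I_K) : {set pixel M N} := Omt s :&: Omt t.

(* The disjoint union of the interfaces over s < t: the element ((s, t), p) is
   the point p of the interface of s and t. *)
Definition interfaces : finType :=
  {x : ('I_K * 'I_K) * pixel M N |
    (x.1.1 < x.1.2)%N && (x.2 \in interface x.1.1 x.1.2)}.

Definition jump (ut : {ffun 'I_K -> V}) : {ffun interfaces -> R^o} :=
  [ffun x => let: ((s, t), p) := val x in ut s p - ut t p].

Lemma jump_is_linear : linear jump.
Proof.
move=> a ut vt; apply/ffunP => -[[[s t] p] stp]; rewrite !ffunE /=.
by rewrite !ffunE scalerBr opprD addrACA.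
Qed.

Definition glues (ut : {ffun 'I_K -> V}) (u : V) : Prop :=
  forall s, restr (Omt s) u = restr (Omt s) (ut s).

End Decomposition.

Definition is_minimizer (R : realType) (X : Type) (C : X -> Prop) (f : X -> R)
    (x : X) : Prop :=
  C x /\ forall y, C y -> f x <= f y.

(* Main.v *)
Require Import Defs.
From mathcomp Require Import all_boot all_order all_algebra.
From mathcomp Require Import boolp reals.

Set Implicit Arguments.
Unset Strict Implicit.
Unset Printing Implicit Defensive.

Import Order.TTheory GRing.Theory Num.Theory.
Local Open Scope ring_scope.

(** The constraint [jump ut = 0] says that the local functions agree on all
overlaps, and the essential domains cover the image because the blocks of the
partition do; so a feasible [ut] is the family of restrictions of exactly one
image [u] ([jump0_glues], [glues_inj]).  Conversely, every image [v] can be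
cut into a feasible family ([split_image]).

The energies correspond under this bijection: the total energy is the sum of
the local ones ([energy_sum_local]) since the blocks partition the image, and
the [s]-th local energy sees its argument only on the essential domain of the
[s]-th block ([local_energy_restr]), so it does not distinguish [u] from
[ut s] ([energyt_glues]).  Hence minimizing the decomposed energy under the
constraint and minimizing the original one are the same problem. *)

Section Decomposition.

Variables (R : realType) (M N K : nat).
Local Notation V := (imageSpace R M N).
Variables (T : V -> V) (Om : 'I_K -> {set pixel M N}).
Implicit Types (u v : V) (ut : {ffun 'I_K -> V}) (s t : 'I_K).

Lemma ess_dom_expressible (D : {set pixel M N}) :
  expressible T D (ess_dom T D).
Proof. by have /minsetP[/asboolP] := ess_dom_minset T D. Qed.

Lemma local_energy_restr s u v :
  restr (Omt T Om s) u = restr (Omt T Om s) v ->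
  local_energy T Om s u = local_energy T Om s v.
Proof.
move=> uv; have /expressibleP TOm := ess_dom_expressible (Om s).
have /restr_eqP Tuv := TOm u v uv.
exact: eq_bigr.
Qed.

Lemma energy_sum_local u :
  rectangular_partition Om -> energy T u = \sum_(s < K) local_energy T Om s u.
Proof.
move=> [Om_inj Om_part _].
transitivity (\sum_(p in [set: pixel M N]) T u p).
  by apply: eq_bigl => p; rewrite inE.
rewrite (set_partition_big _ Om_part) big_imset /=; last exact: in2W.
by apply: eq_bigl => s; rewrite inE.
Qed.

Lemma energyt_glues ut u :
  rectangular_partition Om -> glues T Om ut u -> energyt T Om ut = energy T u.
Proof.
move=> Om_part ut_u; rewrite (energy_sum_local u Om_part).
by apply: eq_bigr => s _; apply: local_energy_restr; rewrite ut_u.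
Qed.

(** The jump records each interface only for [s < t]; the other pairs of
indices follow by symmetry. *)
Lemma jump0_agree ut s t (p : pixel M N) :
  jump T Om ut = 0 -> p \in Omt T Om s -> p \in Omt T Om t -> ut s p = ut t p.
Proof.
move=> jump0; wlog lt_st : s t / (s < t)%N => [agree ps pt|ps pt].
  have [/agree-> //|/agree-> //|eq_st] := ltngtP s t.
  by rewrite (ord_inj eq_st).
have stp : (s < t)%N && (p \in interface T Om s t) by rewrite lt_st inE ps.
have /ffunP/(_ (exist _ ((s, t), p) stp)) := jump0.
by rewrite !ffunE /= => /subr0_eq.
Qed.

Lemma agree_jump0 ut :
  (forall s t (p : pixel M N), p \in Omt T Om s -> p \in Omt T Om t ->
    ut s p = ut t p) ->
  jump T Om ut = 0.
Proof.
move=> agree; apply/ffunP => -[[[s t] p] /= stp]; rewrite !ffunE /=.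
by case/andP: stp => _ /setIP[ps pt]; rewrite (agree s t) ?subrr.
Qed.

Definition split_image v : {ffun 'I_K -> V} :=
  [ffun s => [ffun p => if p \in Omt T Om s then v p else 0]].

Lemma split_image_Vt v : split_image v \in Vt T Om.
Proof.
rewrite inE; apply/forallP => s; rewrite inE; apply/subsetP => p.
by rewrite inE !ffunE; case: ifP => //; rewrite eqxx.
Qed.

Lemma split_image_glues v : glues T Om (split_image v) v.
Proof. by move=> s; apply/restr_eqP => p ps; rewrite !ffunE ps. Qed.

Lemma jump_split_image v : jump T Om (split_image v) = 0.
Proof. by apply: agree_jump0 => s t p ps pt; rewrite !ffunE ps pt. Qed.

Hypothesis Om_part : rectangular_partition Om.
Hypothesis Om_sub : forall s, Om s \subset ess_dom T (Om s).

Lemma ess_dom_cover (p : pixel M N) : exists s, p \in Omt T Om s.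
Proof.
have [_ /cover_partition cov _] := Om_part.
have: p \in cover [set Om s | s : 'I_K] by rewrite cov inE.
case/bigcupP => _ /imsetP[s _ ->] ps.
by exists s; apply: (subsetP (Om_sub s)).
Qed.

Lemma glues_inj ut u v : glues T Om ut u -> glues T Om ut v -> u = v.
Proof.
move=> ut_u ut_v; apply/ffunP => p; have [s ps] := ess_dom_cover p.
have /restr_eqP uv : restr (Omt T Om s) u = restr (Omt T Om s) v.
  by rewrite ut_u ut_v.
exact: uv.
Qed.

Lemma jump0_glues ut : jump T Om ut = 0 -> exists u, glues T Om ut u.
Proof.
move=> jump0.
(* Any local function defined at [p] may serve, as all of them agree there. *)
exists [ffun p => oapp (fun s => ut s p) 0 [pick s | p \in Omt T Om s]].
move=> s; apply/restr_eqP => p ps; rewrite ffunE.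
case: pickP => [t pt|/(_ s)] /=; first exact: jump0_agree.
by rewrite ps.
Qed.

End Decomposition.

Theorem theorem2p2 (R : realType) (M N K : nat)
    (T : imageSpace R M N -> imageSpace R M N) (Om : 'I_K -> {set pixel M N})
    (Om_part : rectangular_partition Om)
    (Om_sub : forall s, Om s \subset ess_dom T (Om s))
    (ut : {ffun 'I_K -> imageSpace R M N})
    (ut_sol : is_minimizer (fun vt => vt \in Vt T Om /\ jump T Om vt = 0)
                (energyt T Om) ut) :
  (exists! u : imageSpace R M N, glues T Om ut u) /\
  (forall u : imageSpace R M N, glues T Om ut u ->
     is_minimizer (fun _ => True) (energy T) u).
Proof.
have [[_ jump0] ut_min] := ut_sol; split.
  have [u ut_u] := jump0_glues jump0.
  by exists u; split=> // v; apply: glues_inj ut_u.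
move=> u ut_u; split=> // v _.
rewrite -(energyt_glues Om_part ut_u).
rewrite -(energyt_glues Om_part (split_image_glues T Om v)).
apply: ut_min; split; first exact: split_image_Vt.
exact: jump_split_image.
Qed.
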